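(* Let $T$ be a self-adjoint operator in a complex Hilbert space $\mathcal H$ with infinitely many spectral gaps $(\alpha_n,\beta_n)$, $n\in\mathbb N$, i.e. $\sigma(T)\cap(\alpha_n,\beta_n)=\emptyset$ with $\alpha_n,\beta_n\in\sigma(T)$, such that $\alpha_n<\beta_n\le\alpha_{n+1}$, $n\in\mathbb N$, and $\alpha_n\to\infty$ as $n\to\infty$. Let $A$ be a $T$-bounded linear operator in $\mathcal H$ with $T$-bound $\delta_A<1$. (i) If $$\limsup_{n\to\infty}\frac{\beta_n}{\alpha_n}>\frac{1+\delta_A}{1-\delta_A},$$ then $T+A$ has infinitely many stable spectral free strips; if even $$\liminf_{n\to\infty}\frac{\beta_n}{\alpha_n}>\frac{1+\delta_A}{1-\delta_A},$$ then at most finitely many of the spectral gaps $(\alpha_n,\beta_n)$ of $T$ close under perturbation by $A$. (ii) Let $a_n,b_n\ge0$, $b_n<1$, $n\in\mathbb N$, be such that, for every $n\in\mathbb N$, $$\|Ax\|^2\le a_n^2\|x\|^2+b_n^2\|Tx\|^2,\qquad x\in\mathcal D(T).$$ If $$\liminf_{n\to\infty}\frac{\sqrt{a_n^2+b_n^2\alpha_n^2}+\sqrt{a_n^2+b_n^2\beta_n^2}}{\beta_n-\alpha_n}<1,$$ then $T+A$ has infinitely many stable spectral free strips; if even $$\limsup_{n\to\infty}\frac{\sqrt{a_n^2+b_n^2\alpha_n^2}+\sqrt{a_n^2+b_n^2\beta_n^2}}{\beta_n-\alpha_n}<1,$$ then at most finitely many of the spectral gaps $(\alpha_n,\beta_n)$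 of $T$ close under perturbation by $A$.
   Context: $\mathcal D(\cdot)$ denotes the domain. A linear operator $A$ (not necessarily symmetric, closed or bounded) is $T$-bounded if $\mathcal D(T)\subset\mathcal D(A)$ and there are $a,b\ge0$ with $\|Ax\|^2\le a^2\|x\|^2+b^2\|Tx\|^2$ for all $x\in\mathcal D(T)$; the infimum $\delta_A$ of all $b\ge 0$ for which such an $a\ge 0$ exists is the $T$-bound of $A$. The operators $T+sA$ have domain $\mathcal D(T)$. We say that the gap $(\alpha_n,\beta_n)$ gives rise to a stable spectral free strip of $T+A$ if there is a nonempty open subinterval $(\alpha_n',\beta_n')\subset(\alpha_n,\beta_n)$ with $$\sigma(T+sA)\cap\{z\in\mathbb C:\alpha_n'<\operatorname{Re} z<\beta_n'\}=\emptyset\quad\text{for all }s\in[0,1].$$ ''$T+A$ has infinitely many stable spectral free strips'' means that this holds for infinitely many $n\in\mathbb N$; ''at most finitely many spectral gaps of $T$ close under perturbation by $A$'' means that it holds for all but finitely many $n\in\mathbb N$. (Since $\alpha_n\to\infty$, the quotients $\beta_n/\alpha_n$ are defined for all sufficiently large $n$.) *)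

(* Defs.v *)
From mathcomp Require Import all_boot all_order all_algebra.
From mathcomp Require Import sesquilinear complex.
From mathcomp Require Import all_classical all_reals all_analysis.

Set Implicit Arguments.
Unset Strict Implicit.
Unset Printing Implicit Defensive.

Import Order.TTheory GRing.Theory Num.Theory.
Import numFieldNormedType.Exports.

Local Open Scope classical_set_scope.
Local Open Scope ring_scope.
Local Open Scope complex_scope.

(* A linear operator defined on a linear subspace [dom]; the values of
   [opfun] outside [dom] are irrelevant. *)
Record linop (K : numFieldType) (H : lmodType K) := LinOp {
  dom : set H;
  opfun :> H -> H;
  dom_zero : dom 0;
  dom_lin : forall (c : K) (x y : H), dom x -> dom y -> dom (c *: x + y);
  op_lin : forall (c : K) (x y : H), dom x -> dom y ->
    opfun (c *: x + y) = c *: opfun x + opfun y }.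

Section algebra.
Context {K : numFieldType} {H : lmodType K}.
Implicit Types S T : linop H.

Lemma dom_lin_sum S T (c : K) (x y : H) :
  (dom S `&` dom T) x -> (dom S `&` dom T) y -> (dom S `&` dom T) (c *: x + y).
Proof. by move=> [Sx Tx] [Sy Ty]; split; apply: dom_lin. Qed.

Lemma op_lin_sum S T (c : K) (x y : H) :
  (dom S `&` dom T) x -> (dom S `&` dom T) y ->
  S (c *: x + y) + T (c *: x + y) = c *: (S x + T x) + (S y + T y).
Proof.
by move=> [Sx Tx] [Sy Ty]; rewrite !op_lin// scalerDr addrACA.
Qed.

(* The sum S + T on the usual domain D(S) `&` D(T). *)
Definition linop_sum S T : linop H :=
  @LinOp K H (dom S `&` dom T) (fun x => S x + T x)
    (conj (dom_zero S) (dom_zero T)) (@dom_lin_sum S T) (@op_lin_sum S T).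

Lemma op_lin_scale (k : K) T (c : K) (x y : H) : dom T x -> dom T y ->
  k *: T (c *: x + y) = c *: (k *: T x) + k *: T y.
Proof. by move=> Tx Ty; rewrite op_lin// scalerDr !scalerA mulrC. Qed.

(* k T, on the domain of T (also for k = 0). *)
Definition linop_scale (k : K) T : linop H :=
  @LinOp K H (dom T) (fun x => k *: T x) (dom_zero T) (@dom_lin K H T)
    (@op_lin_scale k T).

Definition linop_graph T : set (H * H) := [set p | dom T p.1 /\ p.2 = T p.1].

End algebra.

Section hilbert.
Context {R : realType} {H : completeNormedModType R[i]}.
Implicit Types S T A : linop H.

(* The form is linear in its first argument, antilinear in the second and
   positive definite; with this condition the complete normed space H is a
   complex Hilbert space. *)
Definition is_inner_product (ip : {dot H for (@Num.conj R[i])}) : Prop :=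
  forall x : H, `|x| ^+ 2 = ip x x.

(* The adjoint as a relation; it is the graph of an operator when T is
   densely defined. *)
Definition adjoint_graph (ip : {dot H for (@Num.conj R[i])}) T : set (H * H) :=
  [set p | forall x, dom T x -> ip (T x) p.1 = ip x p.2].

Definition selfadjoint (ip : {dot H for (@Num.conj R[i])}) T : Prop :=
  closure (dom T) = setT /\ adjoint_graph ip T = linop_graph T.

(* T - z is a bijection from D(T) onto H with bounded inverse. *)
Definition resolvent_set T : set R[i] :=
  [set z | exists B : {linear H -> H},
    [/\ continuous (B : H -> H),
        forall y, dom T (B y) /\ T (B y) - z *: B y = y
      & forall x, dom T x -> B (T x - z *: x) = x]].

Definition spectrum T : set R[i] := ~` resolvent_set T.

(* Norms on H take values in R[i], hence the injections of a and b. *)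
Definition rel_bound T A (a b : R) : Prop :=
  forall x, dom T x ->
    `|A x| ^+ 2 <= a%:C ^+ 2 * `|x| ^+ 2 + b%:C ^+ 2 * `|T x| ^+ 2.

Definition rel_bounds T A : set R :=
  [set b | 0 <= b /\ exists2 a, 0 <= a & rel_bound T A a b].

Definition rel_bounded T A : Prop :=
  dom T `<=` dom A /\ rel_bounds T A !=set0.

(* The T-bound of A, meaningful when A is T-bounded. *)
Definition Tbound T A : R := inf (rel_bounds T A).

Definition perturb T A (s : R) : linop H := linop_sum T (linop_scale s%:C A).

Lemma dom_perturb T A (s : R) : rel_bounded T A -> dom (perturb T A s) = dom T.
Proof. by case=> TA _; apply/setIidPl. Qed.

Definition stable_free_strip T A (alpha beta : R) : Prop :=
  exists alpha' beta' : R,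
    [/\ alpha <= alpha', alpha' < beta', beta' <= beta &
      forall s : R, 0 <= s <= 1 ->
        spectrum (perturb T A s) `&`
          [set z | alpha' < complex.Re z < beta'] = set0].

Definition infinitely_many_strips T A (alpha beta : nat -> R) : Prop :=
  infinite_set [set n | stable_free_strip T A (alpha n) (beta n)].

Definition finitely_many_gaps_close T A (alpha beta : nat -> R) : Prop :=
  finite_set [set n | ~ stable_free_strip T A (alpha n) (beta n)].

Definition spectral_gap T (alpha beta : R) : Prop :=
  [/\ alpha < beta, spectrum T alpha%:C, spectrum T beta%:C &
    forall x : R, alpha < x < beta -> ~ spectrum T x%:C].

Definition gap_quotient (alpha beta a b : nat -> R) (n : nat) : R :=
  (Num.sqrt (a n ^+ 2 + b n ^+ 2 * alpha n ^+ 2)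
   + Num.sqrt (a n ^+ 2 + b n ^+ 2 * beta n ^+ 2)) / (beta n - alpha n).

End hilbert.

(* Main.v *)
From HB Require Import structures.
Require Import Defs.
From mathcomp Require Import all_boot all_order all_algebra.
From mathcomp Require Import sesquilinear complex.
From mathcomp Require Import all_classical all_reals all_analysis.
From mathcomp Require Import ring lra.
Import Order.TTheory GRing.Theory Num.Theory.
Import numFieldNormedType.Exports.
Local Open Scope classical_set_scope.
Local Open Scope ring_scope.
Local Open Scope complex_scope.

Set Implicit Arguments.
Unset Strict Implicit.
Unset Printing Implicit Defensive.

(* If mu lies between alpha + sqrt(a^2 + b^2 alpha^2) and
   beta - sqrt(a^2 + b^2 beta^2), then for some q < 1 the quadratic polynomial
   q^2 (t - mu)^2 - b^2 t^2 - a^2 is nonnegative outside the gap (alpha, beta);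
   applied to T this gives |A x| <= q |(T - mu) x| <= q |(T - z) x| for every z
   with real part mu, and a Neumann series then puts z in the resolvent set of
   T + s A.
   Instead of the spectral theorem, the proof factors the polynomial as
   c ((t - m)^2 - d^2) and uses |(T - m) x| >= d |x| whenever (m - d, m + d) is
   free of spectrum: if e is the best constant in |(T - m) x| >= e |x| and
   e < d, then both m - e and m + e are in the resolvent set, which allows e to
   be increased. *)

Lemma complex_ReZ (R : rcfType) (k : R) (z : R[i]) :
  complex.Re (k%:C * z) = k * complex.Re z.
Proof. by case: z => a b; rewrite /= mul0r subr0. Qed.

(** * Real-valued norm, real inner product and geometric convergence *)

Section hilbert_norm.
Context {R : realType} {H : completeNormedModType R[i]}.
Implicit Types x y : H.

(** Norms on [H] take values in [R[i]]; the real part moves every estimate into the totally ordered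
    field [R]. *)
Definition rnorm x : R := complex.Re `|x|.

Lemma rnormE x : `|x| = (rnorm x)%:C.
Proof. by rewrite /rnorm RRe_real. Qed.

Lemma rnorm_ge0 x : 0 <= rnorm x.
Proof. by rewrite -ler0c -rnormE. Qed.

Lemma rnorm_eq0 x : rnorm x = 0 -> x = 0.
Proof. by move=> x0; apply/normr0_eq0; rewrite rnormE x0. Qed.

Lemma rnorm0 : rnorm (0 : H) = 0.
Proof. by rewrite /rnorm normr0. Qed.

Lemma rnormD x y : rnorm (x + y) <= rnorm x + rnorm y.
Proof. by rewrite -lecR rmorphD /= -!rnormE ler_normD. Qed.

Lemma rnormN x : rnorm (- x) = rnorm x.
Proof. by rewrite /rnorm normrN. Qed.

Lemma rnormB x y : rnorm (x - y) <= rnorm x + rnorm y.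
Proof. by rewrite -(rnormN y) rnormD. Qed.

Lemma rnormZr (k : R) x : rnorm (k%:C *: x) = `|k| * rnorm x.
Proof.
apply: (@complexI R); rewrite -rnormE normrZ rmorphM /= -rnormE; congr (_ * _).
by rewrite normc_def /= expr0n /= addr0 sqrtr_sqr.
Qed.

Lemma rnormZ (k : R[i]) x : rnorm (k *: x) = complex.Re `|k| * rnorm x.
Proof.
by apply: (@complexI R); rewrite -rnormE normrZ rmorphM /= -rnormE; congr (_ * _); rewrite -[LHS]RRe_real.
Qed.

Context (ip : {dot H for (@Num.conj R[i])}) (hip : is_inner_product ip).

(** The real part of the form is symmetric and bilinear over [R], which is what the expansion of
    squared norms uses. *)
Definition rip x y : R := complex.Re (ip x y).

Lemma rnorm_sq x : rnorm x ^+ 2 = rip x x.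
Proof. by apply: (@complexI R); rewrite /rip -hip rnormE -rmorphXn. Qed.

Lemma ripC x y : rip x y = rip y x.
Proof.
rewrite /rip (hermC ip x y) /= expr0 mul1r. by case: (ip y x).
Qed.

Lemma ripDl x y z : rip (x + y) z = rip x z + rip y z.
Proof. by rewrite /rip linearDl [LHS](raddfD (@complex.Re R)). Qed.

Lemma ripZl k x z : rip (k%:C *: x) z = k * rip x z.
Proof.
by rewrite /rip linearZl_LR [LHS]complex_ReZ.
Qed.

Lemma ripZIl x y : rip ('i%C *: x) y = - complex.Im (ip x y).
Proof. by rewrite /rip linearZl_LR mulrC [LHS]ReiNIm. Qed.

Lemma geometric_cauchy (u : nat -> H) (M q : R) : 0 <= q < 1 -> 0 <= M ->
  (forall k, rnorm (u k.+1 - u k) <= M * q ^+ k) ->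
  exists l, forall e, 0 < e -> exists N, forall n, (N <= n)%N -> rnorm (u n - l) < e.
Proof.
move=> /andP[q0 q1] M0 hu.
have tail n m : rnorm (u (n + m)%N - u n) <= M / (1 - q) * q ^+ n.
  (* The induction on [m] runs on the exact partial sum M (q^n - q^(n+m)) / (1 - q) of the geometric
     series; the cruder tail bound is not inductive. *)
  apply: (@le_trans _ _ (M / (1 - q) * (q ^+ n - q ^+ (n + m)))); last first.
    by rewrite ler_wpM2l ?divr_ge0 ?subr_ge0 ?(ltW q1)// gerBl exprn_ge0.
  elim: m => [|m IH]; first by rewrite addn0 !subrr rnorm0 mulr0.
  have -> : u (n + m.+1)%N - u n = (u (n + m).+1 - u (n + m)%N) + (u (n + m)%N - u n).
    by rewrite addnS subrKA.
  apply: (le_trans (rnormD _ _)); apply: (le_trans (lerD (hu _) IH)).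
  rewrite addnS exprS; set p := q ^+ (n + m); set r := q ^+ n.
  have -> : M * p = M / (1 - q) * (p * (1 - q)).
    by field; rewrite subr_eq0 gt_eqF.
  by rewrite -mulrDr le_eqVlt; apply/orP; left; apply/eqP; congr (_ * _); ring.
have Cq e : 0 < e -> exists N, forall n, (N <= n)%N -> M / (1 - q) * q ^+ n < e.
  move=> e0.
  have : geometric (M / (1 - q)) q @ \oo --> 0 by apply: cvg_geometric; rewrite ger0_norm.
  move=> /cvgr0Pnorm_lt /(_ e e0) [N _ hN]; exists N => n Nn.
  by have := hN n Nn; rewrite /= ger0_norm ?mulr_ge0 ?exprn_ge0 ?invr_ge0 ?subr_ge0 ?(ltW q1).
have : cvgn u.
  apply/cauchy_cvgP/cauchy_exP => /= e e0.
  have re0 : (0 < complex.Re e)%R by move: e0; rewrite ltcE => /andP[].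
  have ee : e = (complex.Re e)%:C by rewrite RRe_real ?gtr0_real.
  have [N hN] := Cq _ re0; exists (u N); exists N => //= n /= Nn.
  rewrite -ball_normE /= distrC rnormE ee ltcR.
  by rewrite (le_lt_trans _ (hN N (leqnn _)))// -(subnKC Nn) tail.
move=> /cvg_ex[l /cvgrPdist_lt hl]; exists l => e e0.
have [|N _ hN] := hl e%:C; first by rewrite ltcR.
by exists N => n Nn; rewrite -ltcR -rnormE distrC; apply: hN.
Qed.
End hilbert_norm.

(** * Algebra of operators defined on subspaces *)

Section linop_theory.
Context {K : numFieldType} {H : lmodType K}.
Implicit Types (S : linop H) (x y : H) (k : K).

Lemma dom_add S x y : dom S x -> dom S y -> dom S (x + y).
Proof. by move=> Sx Sy; rewrite -(scale1r x); apply: dom_lin. Qed.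

Lemma dom_scale S k x : dom S x -> dom S (k *: x).
Proof. by move=> Sx; rewrite -(addr0 (k *: x)); apply: dom_lin => //; apply: dom_zero. Qed.

Lemma dom_sub S x y : dom S x -> dom S y -> dom S (x - y).
Proof. by move=> Sx Sy; rewrite -(scaleN1r y) addrC; apply: dom_lin. Qed.

Lemma op_add S x y : dom S x -> dom S y -> S (x + y) = S x + S y.
Proof. by move=> Sx Sy; rewrite -{1}(scale1r x) op_lin// scale1r. Qed.

Lemma op_sub S x y : dom S x -> dom S y -> S (x - y) = S x - S y.
Proof. by move=> Sx Sy; rewrite -(scaleN1r y) addrC op_lin// scaleN1r addrC. Qed.

Lemma op_zero S : S 0 = 0.
Proof. by rewrite -(subrr 0) op_sub ?subrr//; apply: dom_zero. Qed.

Lemma op_scale S k x : dom S x -> S (k *: x) = k *: S x.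
Proof.
by move=> Sx; rewrite -(addr0 (k *: x)) op_lin// ?op_zero ?addr0//; apply: dom_zero.
Qed.

Lemma op_lin_shift S z (k : K) x y : dom S x -> dom S y ->
  S (k *: x + y) - z *: (k *: x + y) = k *: (S x - z *: x) + (S y - z *: y).
Proof.
move=> Sx Sy; rewrite op_lin// scalerBr scalerDr !scalerA (mulrC z).
by rewrite opprD addrACA.
Qed.

Definition linop_shift S (z : K) : linop H :=
  @LinOp K H (dom S) (fun x => S x - z *: x) (dom_zero S) (@dom_lin K H S)
    (@op_lin_shift S z).
End linop_theory.

(** * The resolvent set and its stability under relatively small perturbations *)

Section resolvent.
Context {R : realType} {H : completeNormedModType R[i]}.
Implicit Types (S T A : linop H) (x y : H).

(** The lower bound encodes both injectivity and boundedness of the inverse, so membership in the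
    resolvent set becomes a matter of norm estimates on the operator itself. *)
Definition bounded_bijection S :=
  (exists2 c : R, 0 < c & forall x, dom S x -> c * rnorm x <= rnorm (S x)) /\
  (forall y, exists2 x, dom S x & S x = y).

(** From right to left, preimages are picked by choice; the lower bound makes them unique, hence
    linear in [y], and bounded with constant 1/c. *)
Lemma resolvent_setP T z :
  resolvent_set T z <-> bounded_bijection (linop_shift T z).
Proof.
split=> [[B [Bc BT TB]]|[[c c0 hc] surj]].
  have [r r0 Br] : exists2 r : R, 0 < r & forall x, rnorm (B x) <= r * rnorm x.
    have /linear_boundedP/pinfty_ex_gt0[r r0 Br] := (linear_bounded_continuous B).2 Bc.
    have rE : (complex.Re r)%:C = r by rewrite RRe_real ?gtr0_real.
    exists (complex.Re r) => [|x]; first by rewrite -ltcR rE.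
    by rewrite -lecR rmorphM /= -!rnormE rE Br.
  split; last by move=> y; have [Dy yE] := BT y; exists (B y).
  exists r^-1 => [|x Dx]; first by rewrite invr_gt0.
  by rewrite ler_pdivrMl// -{1}(TB x Dx) Br.
pose B0 y := s2val (cid2 (surj y)).
have B0D y : dom T (B0 y) by rewrite /B0; case: cid2.
have B0E y : T (B0 y) - z *: B0 y = y by rewrite /B0; case: cid2.
have inj x y : dom T x -> dom T y ->
    linop_shift T z x = linop_shift T z y -> x = y.
  move=> Dx Dy E; apply/subr0_eq/rnorm_eq0/eqP; rewrite eq_le rnorm_ge0 andbT.
  rewrite -(ler_pM2l c0) mulr0 (le_trans (hc _ (dom_sub _ _)))//.
  by rewrite op_sub// E subrr rnorm0.
have Blin : linear B0.
  move=> k x y; apply: inj; [exact: B0D|exact: dom_lin|].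
  by rewrite op_lin//= !B0E.
pose B : {linear H -> H} := HB.pack B0 (GRing.isLinear.Build _ _ _ _ B0 Blin).
exists B; split=> [|y|x Dx].
- apply/linear_bounded_continuous/bounded_funP => r.
  exists ((c^-1)%:C * r) => x xr; rewrite (le_trans _ (_ : (c^-1)%:C * `|x| <= _))//.
    rewrite !rnormE -rmorphM lecR /= ler_pdivlMl//.
    by rewrite (le_trans (hc _ (B0D x)))//= B0E.
  by rewrite ler_wpM2l// ler0c invr_ge0 ltW.
- by split; [exact: B0D|exact: B0E].
- by apply: inj => //=; rewrite ?B0E.
Qed.

(* Neumann iteration. The limit is taken of the images S (x k), not of x k, so
   that S need not be closed. *)
Lemma bounded_bijection_stable S S' (q : R) : dom S' = dom S -> 0 <= q < 1 ->
  (forall x, dom S x -> rnorm (S' x - S x) <= q * rnorm (S x)) ->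
  bounded_bijection S -> bounded_bijection S'.
Proof.
move=> DS /andP[q0 q1] hq [[c c0 hc] surj]; split.
  exists ((1 - q) * c) => [|x]; first by rewrite mulr_gt0 ?subr_gt0.
  rewrite DS => Dx; rewrite -mulrA.
  apply: (@le_trans _ _ ((1 - q) * rnorm (S x))).
    by rewrite ler_wpM2l ?subr_ge0 ?(ltW q1)// hc.
  rewrite mulrBl mul1r lerBlDr -{1}(subKr (S' x) (S x)).
  by rewrite (le_trans (rnormB _ _))// lerD2l hq.
move=> y.
pose B y := s2val (cid2 (surj y)).
have BD v : dom S (B v) by rewrite /B; case: cid2.
have BE v : S (B v) = v by rewrite /B; case: cid2.
(* Each step adds the [S]-preimage of the residual r = y - S' x. The new residual is (S - S') (B r),
   which is smaller by the factor [q]. *)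
pose x k := iter k (fun x => x + B (y - S' x)) 0.
have xD k : dom S (x k) by elim: k => [|k IH]; [exact: dom_zero|apply: dom_add].
have D' v : dom S v -> dom S' v by rewrite DS.
have res k : rnorm (y - S' (x k)) <= rnorm y * q ^+ k.
  elim: k => [|k IH]; first by rewrite /= op_zero subr0 mulr1.
  rewrite /= -/(x k) (op_add (D' _ (xD k)) (D' _ (BD _))) opprD addrA.
  rewrite -{1}(BE (y - S' (x k))) -rnormN opprB.
  apply: (le_trans (hq _ (BD _))); rewrite BE exprS mulrCA.
  by rewrite ler_wpM2l.
have [l hl] : exists l, forall e, 0 < e ->
    exists N, forall n, (N <= n)%N -> rnorm (S (x n) - l) < e.
  apply: (@geometric_cauchy _ _ _ (rnorm y) q); rewrite ?q0 ?rnorm_ge0// => k.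
  by rewrite /= -/(x k) op_add// addrAC subrr add0r BE res.
exists (B l); first exact: D'.
apply/eqP; rewrite -subr_eq0; apply/eqP/rnorm_eq0/eqP.
rewrite eq_le rnorm_ge0 andbT; apply/ler_addgt0Pl => e e0; rewrite addr0.
have e4 : 0 < e / 4 by rewrite divr_gt0.
have [N hN] := hl _ e4.
have [M _ hM] : \forall n \near \oo, rnorm y * q ^+ n < e / 4.
  have : geometric (rnorm y) q @ \oo --> 0 by apply: cvg_geometric; rewrite ger0_norm.
  move=> /cvgr0Pnorm_lt /(_ _ e4); apply: filterS => n /=.
  by rewrite ger0_norm ?mulr_ge0 ?exprn_ge0 ?rnorm_ge0.
pose n := maxn N M.
have xl := hN n (leq_maxl _ _); have xr := hM n (leq_maxr _ _).
have Dd := dom_sub (BD l) (xD n).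
(* Since S (B l - x n) = l - S (x n) is small, the relative bound controls the first term: the three
   terms are at most q e/4, e/4 and e/4. *)
have -> : S' (B l) - y = (S' (B l - x n) - S (B l - x n)) + S (B l - x n)
     - (y - S' (x n)).
  by rewrite subrK (op_sub (D' _ (BD l)) (D' _ (xD n))) opprB addrA subrK.
apply: (le_trans (rnormB _ _)); apply: (le_trans (lerD (rnormD _ _) (res n))).
have SE : rnorm (S (B l - x n)) = rnorm (S (x n) - l).
  by rewrite (op_sub (BD l) (xD n)) BE -rnormN opprB.
have := hq _ Dd; rewrite SE.
have : q * rnorm (S (x n) - l) <= rnorm (S (x n) - l).
  by rewrite ler_piMl ?rnorm_ge0// ltW.
lra.
Qed.
End resolvent.

(** * Symmetric operators: lower bounds inside spectral gaps and vertical lines of the resolvent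
    set *)

Section symmetric.
Context {R : realType} {H : completeNormedModType R[i]}.
Context (ip : {dot H for (@Num.conj R[i])}) (hip : is_inner_product ip).
Implicit Types (S T A : linop H) (x y : H).

Lemma rnormD_sq (k : R) x y :
  rnorm (x + k%:C *: y) ^+ 2
  = rnorm x ^+ 2 + 2 * k * rip ip x y + k ^+ 2 * rnorm y ^+ 2.
Proof.
rewrite !(rnorm_sq hip) ripDl ripZl (ripC ip x) (ripC ip y (x + _)) !ripDl !ripZl.
by rewrite (ripC ip y x); ring.
Qed.

Lemma rnormB_sq (k : R) x y :
  rnorm (x - k%:C *: y) ^+ 2
  = rnorm x ^+ 2 - 2 * k * rip ip x y + k ^+ 2 * rnorm y ^+ 2.
Proof. by rewrite -scaleNr -rmorphN /= rnormD_sq; ring. Qed.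

Definition symmetric_op T :=
  forall x y, dom T x -> dom T y -> ip (T x) y = ip x (T y).

Lemma selfadjoint_symmetric T : selfadjoint ip T -> symmetric_op T.
Proof.
move=> [_ TE] x y Tx Ty.
have : linop_graph T (y, T y) by [].
by rewrite -TE => /(_ x Tx).
Qed.

Lemma symmetric_shift T (m : R) :
  symmetric_op T -> symmetric_op (linop_shift T m%:C).
Proof.
move=> hT x y Tx Ty /=; rewrite linearBl linearBr; congr (_ - _); first exact: hT.
rewrite linearZl_LR linearZr_LR /=; congr (_ * _).
exact/esym/conjc_real.
Qed.

(** Symmetry makes <x, T x> real, so i x and T x are orthogonal for the real inner product. *)
Lemma symmetric_ripi T x : symmetric_op T -> dom T x -> rip ip ('i%C *: x) (T x) = 0.
Proof.
move=> hT Tx; rewrite ripZIl.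
have : ip x (T x) = (ip x (T x))^*%C.
  by rewrite -{1}(hT _ _ Tx Tx) (hermC ip (T x) x) expr0 mul1r.
by case: (ip x (T x)) => a b /= [] bE; lra.
Qed.

(** In T - z = (T - Re z) - i Im z the cross term vanishes by symmetry, so the squared norm exceeds
    that of (T - Re z) x by (Im z)^2 |x|^2. *)
Lemma symmetric_shift_Re_le T (z : R[i]) x : symmetric_op T -> dom T x ->
  rnorm (T x - (complex.Re z)%:C *: x) <= rnorm (T x - z *: x).
Proof.
move=> hT Tx; rewrite -ler_sqr ?nnegrE ?rnorm_ge0//.
have -> : T x - z *: x = (T x - (complex.Re z)%:C *: x)
    - (complex.Im z)%:C *: ('i%C *: x).
  by rewrite scalerA -addrA -opprD -scalerDl (mulrC _ 'i%C) -complexE.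
have := symmetric_ripi (symmetric_shift (m := complex.Re z) hT) Tx.
rewrite [leRHS]rnormB_sq [rip _ (_ - _) _]ripC /= => ->.
by rewrite mulr0 subr0 lerDl mulr_ge0 ?sqr_ge0.
Qed.

(* With t = S^-1 u, the vector g = S u - e^2 t equals (S - e)(S + e) t.
   Invertibility of S - e and S + e bounds u by g, while symmetry gives
   |g|^2 <= |S u|^2 - e^2 |u|^2. *)
Lemma symmetric_bound_improves S (e c : R) : symmetric_op S ->
  (forall y, exists2 x, dom S x & S x = y) -> 0 < e -> 0 < c ->
  (forall x, dom S x -> e * rnorm x <= rnorm (S x)) ->
  (forall x, dom S x -> c * rnorm x <= rnorm (S x - e%:C *: x)) ->
  (forall x, dom S x -> c * rnorm x <= rnorm (S x + e%:C *: x)) ->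
  exists2 e' : R, e < e' & forall x, dom S x -> e' * rnorm x <= rnorm (S x).
Proof.
move=> hS surj e0 c0 he hm hp.
(* From S u = g + e^2 t and |t| <= |g| / c^2 one gets e |u| <= |S u| <= K |g|. *)
pose K : R := 1 + e ^+ 2 / c ^+ 2.
have K1 : 1 <= K by rewrite lerDl divr_ge0 ?sqr_ge0.
have K0 : 0 < K by apply: lt_le_trans K1.
have q1 : 1 < 1 + K ^- 2 by rewrite ltrDl invr_gt0 exprn_gt0.
(* Inserting e |u| <= K |g| into |g|^2 <= |S u|^2 - e^2 |u|^2 gives |S u|^2 >= e^2 (1 + K^-2)
   |u|^2. *)
exists (e * Num.sqrt (1 + K ^- 2)).
  by rewrite -{1}(mulr1 e) ltr_pM2l// -{1}sqrtr1 ltr_sqrt// (lt_trans ltr01).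
move=> u Su; have [t St tE] := surj u.
have w := dom_scale e%:C St.
set g := S u - (e ^+ 2)%:C *: t.
have hg : rnorm t <= rnorm g / c ^+ 2.
  rewrite ler_pdivlMr ?exprn_gt0// mulrC expr2 -mulrA.
  apply: (@le_trans _ _ (c * rnorm (u + e%:C *: t))).
    by rewrite ler_pM2l//; have := hp _ St; rewrite tE.
  apply: (le_trans (hm _ (dom_add Su w))); rewrite op_add// op_scale// tE.
  rewrite scalerDr opprD addrA addrK scalerA -rmorphM /= -expr2.
  exact: lexx.
have hu : e * rnorm u <= K * rnorm g.
  apply: (le_trans (he _ Su)); rewrite -(subrK ((e ^+ 2)%:C *: t) (S u)) -/g.
  apply: (le_trans (rnormD _ _)); rewrite mulrDl mul1r lerD2l rnormZr.
  by rewrite ger0_norm ?sqr_ge0// -[leRHS]mulrA (mulrC _^-1) ler_wpM2l ?sqr_ge0.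
(* The cross term is <S u, t> = <u, S t> = |u|^2, and e |t| <= |S t| = |u| absorbs the term e^4
   |t|^2. *)
have hgg : rnorm g ^+ 2 <= rnorm (S u) ^+ 2 - e ^+ 2 * rnorm u ^+ 2.
  have -> : rnorm g ^+ 2
      = rnorm (S u) ^+ 2 - 2 * e ^+ 2 * rnorm u ^+ 2 + (e ^+ 2) ^+ 2 * rnorm t ^+ 2.
    rewrite rnormB_sq; congr (_ - _ * _ + _).
    by rewrite (rnorm_sq hip) -[X in _ = rip _ _ X]tE; congr complex.Re; exact: hS.
  have : (e * rnorm t) ^+ 2 <= rnorm u ^+ 2.
    by rewrite ler_sqr ?nnegrE ?mulr_ge0 ?rnorm_ge0 ?(ltW e0)// -tE he.
  rewrite exprMn => /(ler_wpM2l (sqr_ge0 e)); lra.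
rewrite -ler_sqr ?nnegrE ?mulr_ge0 ?sqrtr_ge0 ?rnorm_ge0 ?(ltW e0)//.
rewrite !exprMn sqr_sqrtr ?ler_wpDl ?invr_ge0 ?sqr_ge0//.
have : (e * rnorm u) ^+ 2 <= (K * rnorm g) ^+ 2.
  by rewrite ler_sqr ?nnegrE ?mulr_ge0 ?rnorm_ge0 ?(ltW e0) ?(ltW K0).
rewrite !exprMn -ler_pdivrMl ?exprn_gt0// => h.
have := le_trans h hgg.
set P := e ^+ 2 * _.
by rewrite mulrDr mulr1 mulrDl -/P -lerBrDl -mulrA mulrCA.
Qed.

(** A vector violating the bound makes d an upper bound of the admissible constants. Their supremum
    s is itself admissible and less than d, so m - s and m + s lie in the resolvent set and s can be
    improved, a contradiction. *)
Lemma symmetric_gap_bound T (m d : R) : symmetric_op T ->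
  (forall r : R, m - d < r < m + d -> resolvent_set T r%:C) ->
  forall x, dom T x -> d * rnorm x <= rnorm (T x - m%:C *: x).
Proof.
move=> hT hres x0 Tx0; have [d0|d0] := leP d 0.
  by rewrite (le_trans _ (rnorm_ge0 _))// mulr_le0_ge0 ?rnorm_ge0.
rewrite leNgt; apply/negP => x0d.
pose E := [set e : R | forall x, dom T x -> e * rnorm x <= rnorm (T x - m%:C *: x)].
have Ed e : E e -> e <= d.
  move=> Ee; rewrite leNgt; apply/negP => de.
  have := lt_le_trans x0d (ler_wpM2r (rnorm_ge0 x0) (ltW de)).
  by rewrite ltNge Ee.
have [[c c0 hc] surj] : bounded_bijection (linop_shift T m%:C).
  by apply/resolvent_setP/hres; rewrite ltrDl gtrBl d0.
have supE : has_sup E by split; [exists c|exists d].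
pose s := sup E.
have Es : E s.
  move=> x Tx; have [->|x0'] := eqVneq (rnorm x) 0.
    by rewrite mulr0 rnorm_ge0.
  have xp : 0 < rnorm x by rewrite lt_def x0' rnorm_ge0.
  rewrite -ler_pdivlMr//; apply: ge_sup; first by exists c.
  by move=> e Ee; rewrite ler_pdivlMr// Ee.
have s0 : 0 < s by apply: (lt_le_trans c0); apply: ub_le_sup => //; exists d.
have sd : s < d.
  rewrite lt_neqAle Ed// andbT; apply/eqP => sd.
  by have := Es x0 Tx0; rewrite sd leNgt x0d.
have [[c1 c10 hc1] _] : bounded_bijection (linop_shift T (m + s)%:C).
  by apply/resolvent_setP/hres; lra.
have [[c2 c20 hc2] _] : bounded_bijection (linop_shift T (m - s)%:C).
  by apply/resolvent_setP/hres; lra.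
have [e' se' he'] : exists2 e' : R, s < e' & E e'.
  apply: (@symmetric_bound_improves (linop_shift T m%:C) s (Num.min c1 c2)) => //.
  - exact: symmetric_shift.
  - by rewrite lt_min c10.
  - move=> x Tx /=; rewrite -addrA -opprD -scalerDl -rmorphD /=.
    by apply: le_trans (hc1 _ Tx); rewrite ler_wpM2r ?rnorm_ge0// ge_min lexx.
  - move=> x Tx /=.
    rewrite (_ : _ + _ = T x - (m - s)%:C *: x); last first.
      by rewrite rmorphB /= scalerBl opprB addrA addrAC.
    by apply: le_trans (hc2 _ Tx); rewrite ler_wpM2r ?rnorm_ge0// ge_min lexx orbT.
have : e' <= s by apply: ub_le_sup => //; exists d.
by rewrite leNgt se'.
Qed.

(* The lower bound c of T - Re z persists along the vertical line through z, so
   N steps of length less than c lead from Re z to z. *)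
Lemma symmetric_resolvent_vertical T (z : R[i]) : symmetric_op T ->
  resolvent_set T (complex.Re z)%:C -> resolvent_set T z.
Proof.
move=> hT /resolvent_setP hz; apply/resolvent_setP.
have [[c c0 hc] _] := hz.
have [N hN] : exists N : nat, `|complex.Im z| < c * N%:R.
  have := archi_boundP (divr_ge0 (normr_ge0 (complex.Im z)) (ltW c0)).
  by rewrite ltr_pdivrMr// mulrC; exists (Num.bound (`|complex.Im z| / c)).
have N0 : (0 < N)%N.
  by case: N hN => //; rewrite mulr0 ltNge normr_ge0.
have NR0 : 0 < N%:R :> R by rewrite ltr0n.
pose w k := complex.Re z +i* (complex.Im z * (k%:R / N%:R)).
have wN : w N = z by rewrite /w divff ?gt_eqF// mulr1; case: (z).
rewrite -wN; elim: (N in w N) => [|k IH].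
  by rewrite /w mul0r mulr0.
apply: (@bounded_bijection_stable _ _ _ _ (`|complex.Im z| / (c * N%:R)) _ _ _ IH) => //.
  by rewrite divr_ge0 ?mulr_ge0 ?(ltW c0)//= ltr_pdivrMr ?mul1r ?mulr_gt0.
move=> x Tx /=.
have -> : T x - w k.+1 *: x - (T x - w k *: x)
    = (- (complex.Im z / N%:R))%:C *: ('i%C *: x).
  rewrite opprB addrC addrA subrK -scalerBl scalerA; congr (_ *: _).
  apply/eqP; rewrite eq_complex /=; apply/andP; split; apply/eqP.
    by ring.
  by rewrite -natr1; field; rewrite gt_eqF.
rewrite rnormZr normrN rnormZ normc_def /= expr0n expr1n add0r sqrtr1 mul1r.
rewrite normrM normfV (ger0_norm (ltW NR0)).
have h := le_trans (hc _ Tx) (symmetric_shift_Re_le (w k) hT Tx).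
rewrite invfM -!mulrA ler_wpM2l// mulrCA ler_wpM2l ?invr_ge0 ?ler0n//.
by rewrite ler_pdivlMl.
Qed.
End symmetric.

(** * From quadratic polynomials of the operator to a stable free strip *)

Section perturbation.
Context {R : realType} {H : completeNormedModType R[i]}.
Context (ip : {dot H for (@Num.conj R[i])}) (hip : is_inner_product ip).
Implicit Types (T A : linop H).

(* The polynomial is negative or zero at mu, so its roots m - d and m + d exist,
   enclose mu, and lie in [alpha, beta]. *)
Lemma symmetric_quadratic_ge0 T (alpha beta mu p q r : R) : symmetric_op ip T ->
  (forall t : R, alpha < t < beta -> resolvent_set T t%:C) ->
  0 < p -> alpha < mu < beta ->
  0 <= p * alpha ^+ 2 + q * alpha + r -> 0 <= p * beta ^+ 2 + q * beta + r ->
  p * mu ^+ 2 + q * mu + r <= 0 ->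
  forall x, dom T x ->
    0 <= p * rnorm (T x) ^+ 2 + q * rip ip (T x) x + r * rnorm x ^+ 2.
Proof.
move=> hT hres p0 /andP[amu mub] pa pb pmu x Tx.
(* Completing the square: the polynomial equals p ((t - m)^2 - D). *)
pose m := - q / (2 * p); pose D := m ^+ 2 - r / p; pose d := Num.sqrt D.
have pE t : p * t ^+ 2 + q * t + r = p * ((t - m) ^+ 2 - D).
  by rewrite /D /m; field; rewrite gt_eqF.
move: pa pb pmu; rewrite !pE !pmulr_rge0// pmulr_rle0// !subr_ge0 subr_le0.
move=> pa pb pmu.
have D0 : 0 <= D by apply: le_trans pmu; rewrite sqr_ge0.
have dmu : `|mu - m| <= d by rewrite -sqrtr_sqr ler_wsqrtr.
have da : d <= `|alpha - m| by rewrite -sqrtr_sqr ler_wsqrtr.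
have db : d <= `|beta - m| by rewrite -sqrtr_sqr ler_wsqrtr.
have d0 : 0 <= d by apply: sqrtr_ge0.
move: dmu; rewrite ler_norml => /andP[dmu1 dmu2].
(* Since [m - d, m + d] contains mu and alpha < mu < beta, alpha can only lie to its left and beta
   to its right. *)
have am : alpha <= m - d by move: da; rewrite ler_normr => /orP[]; lra.
have bm : m + d <= beta by move: db; rewrite ler_normr => /orP[]; lra.
have /(symmetric_gap_bound hip hT) : forall t : R, m - d < t < m + d -> resolvent_set T t%:C.
  by move=> t /andP[t1 t2]; apply: hres; rewrite (le_lt_trans am)//= (lt_le_trans t2).
move=> /(_ x Tx); rewrite -ler_sqr ?nnegrE ?mulr_ge0 ?rnorm_ge0//.
rewrite (rnormB_sq hip) exprMn sqr_sqrtr// => h.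
have -> : p * rnorm (T x) ^+ 2 + q * rip ip (T x) x + r * rnorm x ^+ 2
  = p * (rnorm (T x) ^+ 2 - 2 * m * rip ip (T x) x + m ^+ 2 * rnorm x ^+ 2
     - D * rnorm x ^+ 2).
  by rewrite /D /m; field; rewrite gt_eqF.
by rewrite pmulr_rge0// subr_ge0.
Qed.

Lemma rel_boundP T A (a b : R) : rel_bound T A a b -> forall x, dom T x ->
  rnorm (A x) ^+ 2 <= a ^+ 2 * rnorm x ^+ 2 + b ^+ 2 * rnorm (T x) ^+ 2.
Proof.
move=> h x /h; rewrite !rnormE -!rmorphXn -!rmorphM -rmorphD.
by rewrite lecR.
Qed.

(** The last hypothesis puts the ends of the strip, alpha plus the first root and beta minus the
    second, in the right order. One strip serves all s in [0, 1] because |s A x| <= |A x|. *)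
Lemma gap_stable_free_strip T A (alpha beta a b : R) : symmetric_op ip T ->
  (forall t : R, alpha < t < beta -> resolvent_set T t%:C) ->
  rel_bounded T A -> 0 <= b < 1 -> rel_bound T A a b ->
  Num.sqrt (a ^+ 2 + b ^+ 2 * alpha ^+ 2)
    + Num.sqrt (a ^+ 2 + b ^+ 2 * beta ^+ 2) < beta - alpha ->
  stable_free_strip T A alpha beta.
Proof.
move=> hT hres hA /andP[b0 b1] hab.
set sa : R := Num.sqrt _; set sb : R := Num.sqrt _ => hs.
have sa0 : 0 <= sa by apply: sqrtr_ge0.
have sb0 : 0 <= sb by apply: sqrtr_ge0.
have sq0 t : 0 <= a ^+ 2 + b ^+ 2 * t ^+ 2.
  by apply: addr_ge0; [exact: sqr_ge0|apply: mulr_ge0; exact: sqr_ge0].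
have saE : sa ^+ 2 = a ^+ 2 + b ^+ 2 * alpha ^+ 2 by rewrite /sa sqr_sqrtr.
have sbE : sb ^+ 2 = a ^+ 2 + b ^+ 2 * beta ^+ 2 by rewrite /sb sqr_sqrtr.
exists (alpha + sa), (beta - sb); split; [lra|lra|lra|] => s /andP[s0 s1].
rewrite -subset0 => z [] /= + /andP[]; set mu := complex.Re z => sp mu1 mu2.
apply: sp.
have amu : 0 < mu - alpha by lra.
have mub : 0 < beta - mu by lra.
have ga : 0 < (mu - alpha) ^+ 2 - sa ^+ 2.
  by rewrite subr_gt0 ltr_sqr ?nnegrE ?(ltW amu)//; lra.
have gb : 0 < (beta - mu) ^+ 2 - sb ^+ 2.
  by rewrite subr_gt0 ltr_sqr ?nnegrE ?(ltW mub)//; lra.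
have b2 : b ^+ 2 < 1 by rewrite expr_lt1.
have b20 : 0 <= b ^+ 2 by apply: sqr_ge0.
(* With q^2 = 1 - eta, these bounds make (1 - eta) (t - mu)^2 - b^2 t^2 - a^2 nonnegative at alpha
   and beta and keep its leading coefficient positive. *)
have [eta [eta0 etab etaa etabe]] : exists eta : R, [/\ 0 < eta,
    eta <= (1 - b ^+ 2) / 2, eta * (mu - alpha) ^+ 2 <= (mu - alpha) ^+ 2 - sa ^+ 2
    & eta * (beta - mu) ^+ 2 <= (beta - mu) ^+ 2 - sb ^+ 2].
  exists (Num.min ((1 - b ^+ 2) / 2)
    (Num.min (((mu - alpha) ^+ 2 - sa ^+ 2) / (mu - alpha) ^+ 2)
             (((beta - mu) ^+ 2 - sb ^+ 2) / (beta - mu) ^+ 2))).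
  split; first by rewrite !lt_min !divr_gt0 ?exprn_gt0// subr_gt0.
  - by rewrite ge_min lexx.
  - by rewrite -ler_pdivlMr ?exprn_gt0// !ge_min lexx orbT.
  - by rewrite -ler_pdivlMr ?exprn_gt0// !ge_min lexx !orbT.
have eta1 : eta < 1 by lra.
have hquad x : dom T x ->
    a ^+ 2 * rnorm x ^+ 2 + b ^+ 2 * rnorm (T x) ^+ 2
    <= (1 - eta) * rnorm (T x - mu%:C *: x) ^+ 2.
  move=> Tx; rewrite (rnormB_sq hip) -subr_ge0.
  (* The coefficients are those of this polynomial in powers of t; its value at mu is -(a^2 + b^2
     mu^2) <= 0. *)
  have := @symmetric_quadratic_ge0 T alpha beta mu (1 - eta - b ^+ 2)
    (- 2 * mu * (1 - eta)) ((1 - eta) * mu ^+ 2 - a ^+ 2) hT hres.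
  have mu2_ge0 : 0 <= b ^+ 2 * mu ^+ 2 by rewrite mulr_ge0 ?sqr_ge0.
  have a2_ge0 : 0 <= a ^+ 2 by rewrite sqr_ge0.
  move=> /(_ _ _ _ _ _ x Tx) h; apply: le_trans (h _ _ _ _ _) _.
  - by lra.
  - by apply/andP; lra.
  - by lra.
  - by lra.
  - by lra.
  - by rewrite le_eqVlt; apply/orP; left; apply/eqP; ring.
have zT : bounded_bijection (linop_shift T z).
  by apply/resolvent_setP/(symmetric_resolvent_vertical hip hT)/hres/andP; lra.
apply/resolvent_setP.
apply: (@bounded_bijection_stable _ _ _ _ (Num.sqrt (1 - eta)) _ _ _ zT).
- exact: dom_perturb.
- by rewrite sqrtr_ge0/= -[ltRHS]sqrtr1 ltr_sqrt//; lra.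
move=> x Tx /=.
have -> : T x + s%:C *: A x - z *: x - (T x - z *: x) = s%:C *: A x.
  by rewrite (addrAC (T x)) [LHS]addrAC subrr add0r.
rewrite rnormZr ger0_norm//; apply: (@le_trans _ _ (rnorm (A x))).
  by rewrite ler_piMl ?rnorm_ge0.
apply: (@le_trans _ _ (Num.sqrt (1 - eta) * rnorm (T x - mu%:C *: x))).
  rewrite -ler_sqr ?nnegrE ?mulr_ge0 ?sqrtr_ge0 ?rnorm_ge0//.
  rewrite exprMn sqr_sqrtr ?subr_ge0 ?(ltW eta1)//.
  exact: le_trans (rel_boundP hab Tx) (hquad _ Tx).
by rewrite ler_wpM2l ?sqrtr_ge0// (symmetric_shift_Re_le hip).
Qed.
End perturbation.

(** * Upper and lower limits versus frequent and eventual inequalities *)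

Section limits.
Context {R : realType}.
Implicit Types (u : nat -> \bar R) (K : \bar R) (S : set nat).

(** The upper limit is at most the supremum over the tail from N, so some term of that tail exceeds
    K. *)
Lemma lt_limn_esup u K : (K < limn_esup u)%E ->
  forall N, exists2 n, (N <= n)%N & (K < u n)%E.
Proof.
move=> + N; apply: contraPP => h; apply/negP; rewrite -leNgt.
apply: (@le_trans _ _ (ereal_sup (u @` [set n | (N <= n)%N]))).
  by apply: ereal_inf_lbound; exists [set n | (N <= n)%N] => //; exists N.
apply: ge_ereal_sup => _ [n /= Nn <-].
by rewrite leNgt; apply/negP => Kn; apply: h; exists n.
Qed.

Lemma limn_esup_lt u K : (limn_esup u < K)%E -> \forall n \near \oo, (u n < K)%E.
Proof.
move=> /ereal_inf_lt[_ /= [V FV <-] VK]; apply: filterS FV => n Vn.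
by apply: le_lt_trans VK; apply: ereal_sup_ubound; exists n.
Qed.

Lemma limn_einf_lt u K : (limn_einf u < K)%E ->
  forall N, exists2 n, (N <= n)%N & (u n < K)%E.
Proof.
rewrite /limn_einf lteNl => h N; have [n Nn] := lt_limn_esup h N.
by rewrite lteN2; exists n.
Qed.

Lemma lt_limn_einf u K : (K < limn_einf u)%E -> \forall n \near \oo, (K < u n)%E.
Proof.
rewrite /limn_einf lteNr => /limn_esup_lt; apply: filterS => n.
by rewrite lteN2.
Qed.

Lemma cofinal_infinite S : (forall N, exists2 n, (N <= n)%N & S n) -> infinite_set S.
Proof.
move=> hS /finite_seqP[s sE].
have [n] := hS (\max_(i <- s) i).+1.
rewrite sE /= => + ns; rewrite ltnNge => /negP; apply.
exact: (@leq_bigmax_seq _ s predT id n ns isT).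
Qed.

Lemma near_finite_setC S : (\forall n \near \oo, S n) -> finite_set [set n | ~ S n].
Proof.
move=> [N _ hN]; apply: sub_finite_set (finite_II N) => n /= Sn.
by rewrite ltnNge; apply/negP => /hN.
Qed.
End limits.

(** Fixing a real K strictly between threshold and limit makes the later estimates uniform in n; r +
    1 serves when the limit is infinite. *)
Lemma lte_fin_dense (R : realType) (r : R) (x : \bar R) : (r%:E < x)%E ->
  exists2 K : R, r < K & (K%:E < x)%E.
Proof.
case: x => [x||//]; last by exists (r + 1); rewrite ?ltrDl ?ltry.
by rewrite lte_fin => rx; exists ((r + x) / 2); rewrite ?lte_fin midf_lt.
Qed.

Lemma sqrt_sumsq_le (R : rcfType) (x y : R) : 0 <= x -> 0 <= y ->
  Num.sqrt (x ^+ 2 + y ^+ 2) <= x + y.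
Proof.
move=> x0 y0; rewrite -[leRHS](ger0_norm (addr_ge0 x0 y0)) -sqrtr_sqr ler_wsqrtr//.
have := mulr_ge0 x0 y0; lra.
Qed.

(** * Gap quotients and the four conclusions *)

Section quotients.
Context {R : realType} {H : completeNormedModType R[i]}.
Context (ip : {dot H for (@Num.conj R[i])}) (hip : is_inner_product ip).
Implicit Types (T A : linop H).

(** For K > 1 the condition 1 + b < K (1 - b) means b < (K - 1) / (K + 1). The T-bound satisfies it
    strictly, hence so does some admissible b close to this infimum. *)
Lemma Tbound_lt_rel_bound T A (K : R) : rel_bounded T A -> Tbound T A < 1 ->
  (1 + Tbound T A) / (1 - Tbound T A) < K ->
  exists a b : R, [/\ 0 <= a, 0 <= b < 1, rel_bound T A a b
    & 1 + b < K * (1 - b)].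
Proof.
move=> [_ hne] d1; set d : R := Tbound T A => hK.
have d0 : 0 <= d by apply: lb_le_inf => // b [].
have d10 : 0 < 1 - d by rewrite subr_gt0.
move: hK; rewrite ltr_pdivrMr// => hK.
have K1 : 1 < K.
  rewrite ltNge; apply/negP => K1.
  have : K * (1 - d) <= 1 * (1 - d) by rewrite ler_wpM2r// ltW.
  lra.
have K10 : 0 < K + 1 by lra.
have dK : d < (K - 1) / (K + 1) by rewrite ltr_pdivlMr//; lra.
have [b [b0 [a a0 hab]] bK] := inf_lt hne dK.
move: bK; rewrite ltr_pdivlMr// => bK.
exists a, b; split=> //; last by lra.
rewrite b0/= ltNge; apply/negP => b1.
have : 1 * (K + 1) <= b * (K + 1) by rewrite ler_wpM2r// ltW.
lra.
Qed.

(** The two roots sum to at most 2 a + b (alpha + beta), and this is below beta - alpha because (1 -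
    b) beta > (1 - b) K alpha > 2 a + (1 + b) alpha. *)
Lemma quotient_stable_free_strip T A (a b K alpha beta : R) :
  symmetric_op ip T -> (forall t : R, alpha < t < beta -> resolvent_set T t%:C) ->
  rel_bounded T A -> 0 <= a -> 0 <= b < 1 -> rel_bound T A a b ->
  0 < alpha -> 2 * a < (K * (1 - b) - (1 + b)) * alpha -> K < beta / alpha ->
  alpha < beta ->
  stable_free_strip T A alpha beta.
Proof.
move=> hT hres hA a0 /andP[b0 b1] hab al0 hal; rewrite ltr_pdivlMr// => hK hab'.
apply: (gap_stable_free_strip hip hT hres hA _ hab); first by rewrite b0.
have be0 : 0 < beta by apply: lt_trans hab'.
rewrite -!exprMn.
have h1 := sqrt_sumsq_le a0 (mulr_ge0 b0 (ltW al0)).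
have h2 := sqrt_sumsq_le a0 (mulr_ge0 b0 (ltW be0)).
apply: le_lt_trans (lerD h1 h2) _.
have : (1 - b) * (K * alpha) < (1 - b) * beta by rewrite ltr_pM2l ?subr_gt0.
lra.
Qed.
End quotients.

Theorem theorem3p1 (R : realType) (H : completeNormedModType R[i])
  (ip : {dot H for (@Num.conj R[i])}) (hip : is_inner_product ip)
  (T A : linop H) (alpha beta : nat -> R)
  (hT : selfadjoint ip T)
  (hgap : forall n, spectral_gap T (alpha n) (beta n))
  (hord : forall n, beta n <= alpha n.+1)
  (hlim : alpha n @[n --> \oo] --> +oo)
  (hA : rel_bounded T A)
  (hA1 : Tbound T A < 1) :
  ((((1 + Tbound T A) / (1 - Tbound T A))%:E
      < limn_esup (fun n => (beta n / alpha n)%:E))%E ->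
    infinitely_many_strips T A alpha beta)
  /\
  ((((1 + Tbound T A) / (1 - Tbound T A))%:E
      < limn_einf (fun n => (beta n / alpha n)%:E))%E ->
    finitely_many_gaps_close T A alpha beta)
  /\
  (forall a b : nat -> R,
    (forall n, [/\ 0 <= a n, 0 <= b n & b n < 1]) ->
    (forall n, rel_bound T A (a n) (b n)) ->
    ((limn_einf (fun n => (gap_quotient alpha beta a b n)%:E) < 1%:E)%E ->
      infinitely_many_strips T A alpha beta)
    /\
    ((limn_esup (fun n => (gap_quotient alpha beta a b n)%:E) < 1%:E)%E ->
      finitely_many_gaps_close T A alpha beta)).
Proof.
have sT := selfadjoint_symmetric hT.
have ab n : alpha n < beta n by case: (hgap n).
have hres n (t : R) : alpha n < t < beta n -> resolvent_set T t%:C.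
  by move=> ht; have [_ _ _ /(_ t ht)/contrapT] := hgap n.
have hgt (M : R) : \forall n \near \oo, M < alpha n.
  exact: (cvgryPgt _).1 hlim M.
have hquot (K : R) : (1 + Tbound T A) / (1 - Tbound T A) < K ->
    \forall n \near \oo, K < beta n / alpha n ->
      stable_free_strip T A (alpha n) (beta n).
  move=> /(Tbound_lt_rel_bound hA hA1)[a [b [a0 b01 hab hK]]].
  have c0 : 0 < K * (1 - b) - (1 + b) by rewrite subr_gt0.
  near=> n => Kn.
  apply: (@quotient_stable_free_strip _ _ ip hip T A a b K) => //; first exact: hres.
    by near: n; exact: hgt.
  (* Dividing by the positive factor leaves a fixed lower bound for [alpha n], which holds
     eventually as [alpha n] tends to infinity. *)
  rewrite -ltr_pdivrMl//.
  by near: n; exact: hgt.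
have hgq a b : (forall n, [/\ 0 <= a n, 0 <= b n & b n < 1]) ->
    (forall n, rel_bound T A (a n) (b n)) -> forall n,
    ((gap_quotient alpha beta a b n)%:E < 1%:E)%E ->
    stable_free_strip T A (alpha n) (beta n).
  move=> hb hab n; rewrite lte_fin ltr_pdivrMr ?subr_gt0// mul1r => h.
  have [_ b0 b1] := hb n.
  by apply: (gap_stable_free_strip hip sT (hres n) hA _ (hab n) h); rewrite b0.
split; [|split].
- move=> /lte_fin_dense[K /hquot[M _ hM] hK]; apply: cofinal_infinite => N.
  (* The maximum secures both an index beyond N and one past the threshold M from which a quotient
     above K yields a strip. *)
  have [n] := lt_limn_esup hK (maxn N M).
  rewrite geq_max lte_fin => /andP[Nn Mn] Kn.
  by exists n => //; apply: hM.
- move=> /lte_fin_dense[K /hquot hM hK]; apply: near_finite_setC.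
  near=> n; have : K < beta n / alpha n.
    by rewrite -lte_fin; near: n; exact: lt_limn_einf hK.
  by near: n.
- move=> a b hb hab; split.
    move=> h; apply: cofinal_infinite => N.
    by have [n Nn hn] := limn_einf_lt h N; exists n => //; apply: (hgq a b).
  move=> /limn_esup_lt h; apply: near_finite_setC.
  by apply: filterS h => n; apply: hgq.
Unshelve. all: by end_near. Qed.
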